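(* There exist a set $\mathcal{D}$ of positive integers of density $1$ (that is, $\lim_{X\to\infty}\frac{1}{X}\#\{d\leq X: d\in\mathcal{D}\}=1$) and an absolute constant $C>0$ such that for all integers $d,n\geq 2$ with $d\in\mathcal{D}$ and $n\geq d^{1/2}\log d$ one has $$ |r_{d,n}-1|\leq \frac{C}{\sqrt{d}}. $$ In other words, $r_{d,n}=1+O(d^{-1/2})$ for $d\in\mathcal{D}$ and $n\geq d^{1/2}\log d$, with an absolute implied constant.
   Context: For integers $d,n\geq 2$, let $\mathbb{B}_{d,n}$ be the set of hypersurfaces in $\mathbb{P}^n$ (over $\mathbb{Q}$) defined by the vanishing of a homogeneous polynomial of degree $d$ in $x_0,\dots,x_n$ all of whose coefficients (one for each of the $N_{d,n}=\binom{n+d}{d}$ monomials of degree $d$ in $n+1$ variables) lie in $\{-1,1\}$. Two such polynomials are regarded as defining the same hypersurface exactly when they agree up to sign, so $\#\mathbb{B}_{d,n}=2^{N_{d,n}-1}$. Define $$ r_{d,n}=\frac{\#\{V\in\mathbb{B}_{d,n}: V(\mathbb{Q})\neq\emptyset\}}{\#\mathbb{B}_{d,n}}, $$ where $V(\mathbb{Q})$ is the set of points of $\mathbb{P}^n(\mathbb{Q})$ lying on $V$. Here $\log$ is the natural logarithm. *)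

(* Defs.v *)
From HB Require Import structures.
From mathcomp Require Import all_boot all_order all_algebra finmap.
From mathcomp Require Import mpoly.
From mathcomp Require boolp.

Set Implicit Arguments.
Unset Strict Implicit.
Unset Printing Implicit Defensive.

Import GRing.Theory.
Local Open Scope fset_scope.
Local Open Scope ring_scope.

(* Each choice of signs [s] gives a form. The finite type ['X_{1..n.+1 < d.+1}]
   contains all monomials of degree at most [d]; the values of [s] at those of
   smaller degree are ignored, and the image set merges the repetitions. *)
Definition sign_form (d n : nat) (s : {ffun 'X_{1..n.+1 < d.+1} -> bool}) :
    {mpoly rat[n.+1]} :=
  \sum_(m : 'X_{1..n.+1 < d.+1} | mdeg m == d) (-1) ^+ s m *: 'X_[m].

Definition sign_forms (d n : nat) : {fset {mpoly rat[n.+1]}} :=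
  [fset sign_form s | s : {ffun 'X_{1..n.+1 < d.+1} -> bool}].

Lemma sign_formE d n (s : {ffun 'X_{1..n.+1 < d.+1} -> bool}) (m : 'X_{1..n.+1 < d.+1}) :
  (sign_form s)@_m = if mdeg m == d then (-1) ^+ s m else 0.
Proof.
rewrite /sign_form raddf_sum /=.
under eq_bigr => i _ do rewrite mcoeffZ mcoeffX.
case: ifP => hm.
  rewrite (bigD1 m) //= eqxx mulr1 big1 ?addr0 // => i /andP[_ ne].
  by rewrite (_ : (bmnm i == bmnm m) = false) ?mulr0 //; apply: negbTE.
rewrite big1 // => i hi; rewrite (_ : (bmnm i == bmnm m) = false) ?mulr0 //.
by apply/eqP => e; rewrite -e hi in hm.
Qed.

Lemma sign_form_homog d n (s : {ffun 'X_{1..n.+1 < d.+1} -> bool}) :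
  sign_form s \is d.-homog.
Proof.
apply: rpred_sum => m /eqP hm; apply: rpredZ; by rewrite dhomogX; apply/eqP.
Qed.

Lemma sign_formsP d n (F : {mpoly rat[n.+1]}) :
  reflect (F \is d.-homog /\
           forall m : 'X_{1..n.+1}, mdeg m = d -> F@_m \in [:: 1; -1])
    (F \in sign_forms d n).
Proof.
apply: (iffP (imfsetP _ _ _ _)) => /= [[s _ ->]|[hF cF]].
  split=> [|m hm]; first exact: sign_form_homog.
  have lm : (mdeg m < d.+1)%N by rewrite hm.
  have := sign_formE s (BMultinom lm); rewrite /= hm eqxx => ->.
  by case: (s _); rewrite !inE ?expr1 ?expr0 eqxx ?orbT.
exists [ffun m : 'X_{1..n.+1 < d.+1} => F@_m == -1] => //.
apply/mpolyP => m; case: (boolP (mdeg m == d)) => hm.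
  have lm : (mdeg m < d.+1)%N by rewrite (eqP hm).
  rewrite (sign_formE _ (BMultinom lm)) /= hm ffunE /=.
  by move: (cF _ (eqP hm)); rewrite !inE => /orP[]/eqP ->.
by rewrite (dhomog_nemf_coeff hF hm) (dhomog_nemf_coeff (sign_form_homog _) hm).
Qed.

(* A hypersurface is a form up to sign, encoded as the pair {F, - F}. *)
Definition hypersurfaces (d n : nat) : {fset {fset {mpoly rat[n.+1]}}} :=
  [fset [fset F; - F] | F in sign_forms d n].

(* The points of P^n(Q) are the lines through the origin of Q^(n+1). *)
Definition rational_point (n : nat) (V : {fset {mpoly rat[n.+1]}})
    (L : {vspace 'rV[rat]_n.+1}) : Prop :=
  \dim L = 1%N /\
  forall F x, F \in V -> x \in L -> F.@[fun i => x ord0 i] = 0.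

Definition soluble (n : nat) (V : {fset {mpoly rat[n.+1]}}) : Prop :=
  exists L, rational_point V L.

Definition soluble_ratio (d n : nat) : rat :=
  #|` [fset V in hypersurfaces d n | boolp.asbool (soluble V)]|%:R
  / #|` hypersurfaces d n|%:R.

(* Main.v *)
Require Import Defs.
From mathcomp Require Import all_boot all_order all_algebra finmap.
From mathcomp Require mpoly boolp.
From mathcomp Require Import zify ring lra.

(* Let K be the largest power of 2 dividing d, and test only the points e_S whose
   coordinates are 1 on a set S of K+1 variables and 0 elsewhere. The value of a
   sign form at e_S is the sum of the T = 'C(K + d, K) signs of the monomials
   supported in S, and T is even, so it vanishes with probability of order
   T^(-1/2). The monomials with support exactly S form disjoint blocks A_S and
   contain almost all of the T monomials. Conditionally on the signs outside the
   blocks the events are therefore independent, and each still has probability at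
   least 1 / (8 T^(1/2)) unless the signs with smaller support have an untypically
   large sum. By Chebyshev and Markov, with probability 1 - O(d^(-1/2)) at most
   half of the sets S are untypical, and the r = 'C(n + 1, K + 1) available sets
   satisfy r >= (T d)^(1/2) once n >= 2 (K + 1) d^(1/2). The last condition follows
   from n >= d^(1/2) log d if 16^(K + 1) <= d, which holds for almost all d because
   for fixed w the 2-adic valuation of d exceeds w with density 2^(-w-1). *)

Import Order.TTheory GRing.Theory Num.Theory.
Set Implicit Arguments.
Unset Strict Implicit.
Unset Printing Implicit Defensive.
Local Open Scope ring_scope.

(** * Resampling a block *)

Section Resampling.
Variables (I : finType) (R : realFieldType).
Implicit Types (A B s t u : {set I}).

(** A set stands for a choice of signs, with minus on its elements. For uniform [t], splicing
    resamples the signs in the block [A] and keeps the others. *)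
Definition splice A s t : {set I} := (s :\: A) :|: (t :&: A).

Lemma in_splice A s t i :
  (i \in splice A s t) = if i \in A then i \in t else i \in s.
Proof. by rewrite !inE; case: (i \in A); rewrite ?andbT ?andbF ?orbF. Qed.

Lemma splice_splice A s t u : splice A (splice A s t) u = splice A s u.
Proof. by apply/setP => i; rewrite !in_splice; case: (i \in A). Qed.

Lemma spliceAC A B s t u : [disjoint A & B] ->
  splice A (splice B s t) u = splice B (splice A s u) t.
Proof.
move=> dAB; apply/setP => i; rewrite !in_splice.
by case: ifP => // iA; rewrite (disjointFr dAB iA).
Qed.

Lemma splice_setI A B s t : [disjoint A & B] -> splice A s t :&: B = s :&: B.
Proof.
move=> dAB; apply/setP => i; rewrite !inE.
by case: (boolP (i \in B)) => iB; rewrite ?andbF // (disjointFl dAB iB) andbF orbF.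
Qed.

Lemma sum_splice A (f : {set I} -> R) :
  \sum_s \sum_t f (splice A s t) = #|{set I}|%:R * \sum_s f s.
Proof.
(* (s, t) |-> (splice A s t, splice A t s) is an involution of the pairs. *)
pose h (p : {set I} * {set I}) := (splice A p.1 p.2, splice A p.2 p.1).
have hK : involutive h.
  by case=> s t; congr (_, _); apply/setP => i; rewrite !in_splice; case: (i \in A).
rewrite pair_big /= (reindex_inj (inv_inj hK)) /=.
under eq_bigr => p _ do rewrite (_ : splice A _ _ = (h (h p)).1) // hK.
rewrite -(pair_big xpredT xpredT (fun s t => f s)) /= big_distrr /=.
by apply: eq_bigr => s _; rewrite sumr_const mulr_natl.
Qed.

(** The conditional expectation of [f] given the signs outside [A]. *)
Definition mean_splice A (f : {set I} -> R) s : R :=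
  (\sum_t f (splice A s t)) / #|{set I}|%:R.

Lemma card_sets_gt0 : 0 < #|{set I}|%:R :> R.
Proof. by rewrite ltr0n; apply/card_gt0P; exists set0. Qed.

(** Tower property: [g] does not see the block [A], so it passes through the conditional
    expectation. *)
Lemma sum_mean_splice A (f g : {set I} -> R) :
    (forall s t, g (splice A s t) = g s) ->
  \sum_s g s * f s = \sum_s g s * mean_splice A f s.
Proof.
move=> gA; apply: (mulfI (lt0r_neq0 card_sets_gt0)).
rewrite -(sum_splice A) big_distrr /=; apply: eq_bigr => s _.
under eq_bigr => t _ do rewrite gA.
rewrite -big_distrr /= /mean_splice mulrCA; congr (_ * _).
by rewrite mulrC divfK // (lt0r_neq0 card_sets_gt0).
Qed.

(* Conditional independence: F i sees, besides block A i, only what lies outside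
   all the blocks A j. *)
Lemma sum_prod_mean_splice (J : finType) (A : J -> {set I})
    (F : J -> {set I} -> R) :
    (forall i j, i != j -> [disjoint A i & A j]) ->
    (forall i j s t, i != j -> F i (splice (A j) s t) = F i s) ->
  \sum_s \prod_j F j s = \sum_s \prod_j mean_splice (A j) (F j) s.
Proof.
move=> dA FA.
have q_inv i j s t :
    mean_splice (A i) (F i) (splice (A j) s t) = mean_splice (A i) (F i) s.
  rewrite /mean_splice; congr (_ / _); apply: eq_bigr => u _.
  have [->|ij] := eqVneq i j; first by rewrite splice_splice.
  by rewrite spliceAC ?dA // FA.
(* The factors are replaced one block at a time. [g] collects the means already formed; by [q_inv]
   they are unaffected by resampling any block. *)
suff gen (r : seq J) : uniq r -> forall g : {set I} -> R,
    (forall j s t, j \in r -> g (splice (A j) s t) = g s) ->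
    \sum_s g s * \prod_(j <- r) F j s
      = \sum_s g s * \prod_(j <- r) mean_splice (A j) (F j) s.
  have := gen (index_enum J) (index_enum_uniq J) (fun=> 1) (fun _ _ _ _ => erefl).
  by under eq_bigr do rewrite mul1r; under [in RHS]eq_bigr do rewrite mul1r.
elim: r => [|j r IHr] /=; first by move=> _ g _; apply: eq_bigr => s _; rewrite !big_nil.
case/andP => jr ur g gr.
under eq_bigr => s _ do rewrite big_cons mulrCA mulrC.
rewrite (@sum_mean_splice (A j)); last first.
  move=> s t; rewrite gr ?mem_head //; congr (_ * _); rewrite big_seq [RHS]big_seq.
  by apply: eq_bigr => i ir; rewrite FA //; apply: contraNneq jr => <-.
rewrite /=; under eq_bigr => s _ do rewrite mulrAC.
rewrite IHr //; first by apply: eq_bigr => s _; rewrite big_cons mulrA.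
by move=> i s t ir; rewrite q_inv gr // inE ir orbT.
Qed.

End Resampling.

(** * Binomial coefficients *)

(** Sharp at m = 1. The ratio of consecutive central coefficients turns the induction step into
    4m(m+1) <= (2m+1)^2. *)
Lemma central_bin_lower m : (0 < m)%N -> (16 ^ m <= 4 * m * 'C(m.*2, m) ^ 2)%N.
Proof.
elim: m => // -[_ _ //|m] IHm _; have {IHm} := IHm isT.
set c := 'C(m.+1.*2, m.+1); set c' := 'C(m.+2.*2, m.+2) => IHm.
have e : (m.+2 * c' = 2 * m.+1.*2.+1 * c)%N.
  have e1 : (m.+2.*2 * 'C(m.+1.*2.+1, m.+1) = m.+2 * c')%N by rewrite -mul_bin_diag.
  have e2 : (m.+2 * 'C(m.+1.*2.+1, m.+1) = m.+1.*2.+1 * c)%N.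
    have := mul_bin_down m.+1.*2.+1 m.+1; rewrite /= => ->.
    by rewrite (_ : (m.+1.*2.+1 - m.+1 = m.+2)%N) //; lia.
  by rewrite -e1 -[in RHS]mulnA -e2 mulnA; congr (_ * _)%N; lia.
have h : (m.+2 * 16 ^ m.+2 <= m.+2 * (4 * m.+2 * c' ^ 2))%N.
  rewrite (_ : m.+2 * (4 * _ * _) = 4 * (m.+2 * c') ^ 2)%N; last by ring.
  rewrite e expnS.
  have : (m.+2 * 16 * 16 ^ m.+1 <= m.+2 * 16 * (4 * m.+1 * c ^ 2))%N by rewrite leq_mul2l IHm orbT.
  set X := (16 ^ m.+1)%N.
  have : (m.+2 * 16 * (4 * m.+1) * c ^ 2 <= 4 * (2 * m.+1.*2.+1) ^ 2 * c ^ 2)%N.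
    by rewrite leq_mul2r; apply/orP; right; nia.
  by rewrite (expnMn _ c); lia.
by rewrite leq_mul2l in h.
Qed.

(** The lower bound 1 - i^2/m for the ratio to the central coefficient survives the multiplication
    by (m-i)/(m+i+1) that leads to i + 1; it is trivial once (i+1)^2 >= m. *)
Lemma near_central_bin m i :
  ('C(m.*2, m) * m <= 'C(m.*2, m + i) * m + 'C(m.*2, m) * i ^ 2)%N.
Proof.
elim: i => [|i IHi]; first by rewrite addn0 leq_addr.
have [le|lt] := leqP m (i.+1 ^ 2)%N.
  by rewrite (leq_trans _ (leq_addl _ _)) // leq_mul2l le orbT.
have e : ((m + i).+1 * 'C(m.*2, (m + i).+1) = (m - i) * 'C(m.*2, m + i))%N.
  by rewrite mul_bin_left; congr (_ * _)%N; lia.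
rewrite addnS; move: e IHi lt.
set c := 'C(_, (m + i).+1); set b := 'C(_, m + i); set a := 'C(_, m) => e IHi lt.
have im : (i < m)%N by nia.
rewrite -(@leq_pmul2l (m + i).+1) //.
have h1 : (a * m * (m - i) <= (b * m + a * i ^ 2) * (m - i))%N by rewrite leq_mul2r IHi orbT.
have h2 : (b * m * (m - i) = m * ((m + i).+1 * c))%N by rewrite e; ring.
have [k ek] : exists k, m = (i + k)%N by exists (m - i)%N; lia.
have h3 : ((m + i).+1 * m + i ^ 2 * (m - i) <= m * (m - i) + i.+1 ^ 2 * (m + i).+1)%N.
  by rewrite ek addKn; nia.
have h4 : (a * ((m + i).+1 * m + i ^ 2 * (m - i)) <= a * (m * (m - i) + i.+1 ^ 2 * (m + i).+1))%N.
  by rewrite leq_mul2l h3 orbT.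
move: h1 h2 h4; set z := (m - i)%N; clearbody a b c z; clear; nia.
Qed.

(** The constant 64 is a product of three factors 4: one for rounding [M] down to an even number 2m,
    one from [central_bin_lower], and one because by [near_central_bin] a coefficient this close to
    the centre is at least half the central one. *)
Lemma bin_lower M j : (5 < M)%N -> ((j.*2)%:Z - M%:Z) ^+ 2 *+ 4 <= M%:Z ->
  (4 ^ M <= 64 * M * 'C(M, j) ^ 2)%N.
Proof.
move=> M6 jM; pose m := M./2.
have eM : M = (m.*2 + odd M)%N by rewrite addnC odd_double_half.
have m2 : (2 < m)%N by lia.
have half : ('C(m.*2, m) <= 2 * 'C(M, j))%N.
  suff h : ('C(m.*2, m) <= 2 * 'C(m.*2, j))%N.
    by rewrite (leq_trans h) // leq_mul2l leq_bin2l // eM leq_addr.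
  have gen i : (2 * i ^ 2 <= m)%N -> ('C(m.*2, m) <= 2 * 'C(m.*2, m + i))%N.
    move=> im; have := near_central_bin m i.
    set a := 'C(m.*2, m); set b := 'C(m.*2, _) => h.
    rewrite -(@leq_pmul2r m); last by lia.
    have : (a * (2 * i ^ 2) <= a * m)%N by rewrite leq_mul2l im orbT.
    nia.
  have [mj|jm] := leqP m j.
    by rewrite -(subnKC mj); apply: gen; case: (odd M) eM => eM; nia.
  have -> : 'C(m.*2, j) = 'C(m.*2, m + (m - j)).
    by rewrite -bin_sub; [congr 'C(_, _) | ]; lia.
  by apply: gen; case: (odd M) eM => eM; nia.
have := @central_bin_lower m; rewrite (ltn_trans _ m2) // => /(_ isT) cm.
have e4 : (4 ^ M <= 4 * 16 ^ m)%N.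
  rewrite eM expnD -mul2n expnM mulnC leq_mul2r orbC.
  by case: (odd M).
have h2 : ('C(m.*2, m) ^ 2 <= (2 * 'C(M, j)) ^ 2)%N by rewrite leq_exp2r.
have h3 : (m * 'C(m.*2, m) ^ 2 <= M * (2 * 'C(M, j)) ^ 2)%N by apply: leq_mul; lia.
by move: h3; rewrite [in X in (_ <= X)%N -> _]expnMn; lia.
Qed.

Lemma mul_binS k d : (k.+1 * 'C(k.+1 + d, k.+1) = (k.+1 + d) * 'C(k + d, k))%N.
Proof. by rewrite addSn -mul_bin_diag. Qed.

(* The binomial coefficient is (d / K + 1) 'C(K - 1 + d, K - 1) for K = k + 1,
   and d / K is odd. *)
Lemma even_bin_pow2 d k : (0 < d)%N -> k.+1 = (2 ^ logn 2 d)%N ->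
  ~~ odd 'C(k.+1 + d, k.+1).
Proof.
move=> d0 k2; have [u cu du] := pfactor_coprime (isT : prime 2) d0.
have : (k.+1 * 'C(k.+1 + d, k.+1) = k.+1 * (u.+1 * 'C(k + d, k)))%N.
  by rewrite mul_binS {1}du -k2; ring.
move/eqP; rewrite eqn_pmul2l // => /eqP ->.
by rewrite oddM /=; move: cu; rewrite coprime2n => ->.
Qed.

(** Each factor (d + i)/i of the coefficient is at most d + 1. *)
Lemma bin_le_exp k d : ('C(k + d, k) <= d.+1 ^ k)%N.
Proof.
elim: k => [|k IHk]; first by rewrite bin0.
rewrite -(leq_pmul2l (ltn0Sn k)) mul_binS expnS.
by rewrite mulnA leq_mul // mulSn mulnS; lia.
Qed.

(** The induction step reduces to j(N+1) <= (j+1)N, raised to the power j. *)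
Lemma exp_le_bin N j : (j <= N)%N -> (N ^ j <= 'C(N, j) * j ^ j)%N.
Proof.
elim: j N => [|j IHj] [|N] // jN; have := IHj N jN => {}IHj.
have [->|j0] := posnP j; first by rewrite bin1 !expn1 muln1.
rewrite -(@leq_pmul2l (j ^ j)) ?expn_gt0 ?j0 //.
have e : (j ^ j * ('C(N.+1, j.+1) * j.+1 ^ j.+1)
          = N.+1 * (j.+1 ^ j * ('C(N, j) * j ^ j)))%N.
  rewrite expnS; transitivity (j.+1 * 'C(N.+1, j.+1) * (j ^ j * j.+1 ^ j))%N; first by ring.
  by rewrite -mul_bin_diag /=; ring.
rewrite e expnS mulnCA leq_mul2l /=; apply: leq_trans (leq_mul (leqnn _) IHj).
by rewrite -!expnMn leq_exp2r //; lia.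
Qed.

Lemma mul_succ_le_exp2 k : (k * k.+1 <= 2 ^ k.+1)%N.
Proof.
case: k => [|[|k]] //; elim: k => [|k IHk] //.
by rewrite expnS; lia.
Qed.

(** Writing 16 = 4 * 2^2, one part covers the constant 4 and the other the square. This makes
    K(K+1)/d, which bounds the share of monomials in K + 1 variables without full support, at most
    1/2 d^(-1/2). *)
Lemma exp16_ge K d : (16 ^ K.+1 <= d)%N -> (4 * (K * K.+1) ^ 2 <= d)%N.
Proof.
move=> h; apply: leq_trans h; rewrite (_ : 16 = 4 * 4)%N // [leqRHS]expnMn leq_mul //.
  by rewrite expnS leq_pmulr // expn_gt0.
by rewrite (_ : 4 ^ K.+1 = (2 ^ K.+1) ^ 2)%N ?leq_exp2r ?mul_succ_le_exp2 // -expnM mulnC expnM.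
Qed.

(** By [exp_le_bin] the square on the right is at least (4d)^(K+1), while by [bin_le_exp] the left
    side is at most (d+1)^K d. *)
Lemma binom_sqr_ge K d n : (0 < K)%N -> (0 < d)%N -> (4 * d * K.+1 ^ 2 <= n ^ 2)%N ->
  ('C(K + d, K) * d <= 'C(n.+1, K.+1) ^ 2)%N.
Proof.
move=> K0 d0 h; have Kn : (K <= n)%N by rewrite -(leq_exp2r _ _ (isT : 0 < 2)%N); nia.
have := exp_le_bin (Kn : K.+1 <= n.+1)%N; set r := 'C(n.+1, _) => hr.
have hr2 : ((n ^ 2) ^ K.+1 <= r ^ 2 * (K.+1 ^ 2) ^ K.+1)%N.
  rewrite -[leqLHS]expnM -[in leqRHS]expnM (mulnC 2%N) !expnM -expnMn leq_exp2r //.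
  by apply: leq_trans hr; rewrite leq_exp2r.
have h2 : ((4 * d * K.+1 ^ 2) ^ K.+1 <= (n ^ 2) ^ K.+1)%N by rewrite leq_exp2r.
have := leq_trans h2 hr2; rewrite expnMn leq_pmul2r ?expn_gt0 //.
apply: leq_trans; rewrite expnS mulnC leq_mul //; first by lia.
apply: leq_trans (bin_le_exp _ _) _; rewrite leq_exp2r //; lia.
Qed.

(** * Avoiding all balanced traces *)

Lemma card_sets (I : finType) : #|{set I}| = (2 ^ #|I|)%N.
Proof. by have := card_powerset [set: I]; rewrite powersetT !cardsT. Qed.

(** A set amounts to an independent choice of its traces on [A] and on the complement, so the trace
    of a uniform set on [A] has binomially distributed size. *)
Lemma card_trace (I : finType) (A : {set I}) j :
  (#|[set t : {set I} | #|t :&: A| == j]| * 2 ^ #|A| = 'C(#|A|, j) * #|{set I}|)%N.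
Proof.
pose D := setX [set u : {set I} | u \subset A & #|u| == j] (powerset (~: A)).
pose f (p : {set I} * {set I}) := p.1 :|: p.2.
have trace p : p \in D -> f p :&: A = p.1 /\ f p :&: ~: A = p.2.
  rewrite !inE /f => /andP[/andP[uA _] vA]; rewrite !setIUl.
  have /setIidPl -> := uA; have /setIidPl -> := vA.
  split; apply/setP => i; rewrite !inE.
    by move/subsetP/(_ i): vA; rewrite !inE; case: (i \in p.2) => [/(_ isT)/negbTE->|];
      rewrite /= ?andbF orbF.
  by move/subsetP/(_ i): uA; case: (i \in p.1) => [/(_ isT)->|].
have -> : [set t : {set I} | #|t :&: A| == j] = f @: D.
  apply/setP => t; apply/idP/imsetP => [|[p pD ->]].
    rewrite inE => tj; exists (t :&: A, t :\: A); last by rewrite /f setID.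
    by rewrite !inE /= subsetIr tj setDE subsetIr.
  by rewrite inE (trace p pD).1; move: pD; rewrite !inE => /andP[/andP[]].
rewrite card_in_imset; last first.
  move=> [u v] [u' v'] /trace[e1 e2] /trace[e3 e4] e; move: e1 e2 e3 e4.
  by rewrite e /= => -> -> -> ->.
rewrite cardsX cards_draws card_powerset card_sets -mulnA -expnD.
by rewrite addnC cardsC.
Qed.

Section SignSums.
Variables (I : finType) (R : realFieldType).
Implicit Types (A B U s t : {set I}) (i j : I).

Definition sgn s i : R := (-1) ^+ (i \in s).

Lemma sum_sgn s B : \sum_(i in B) sgn s i = #|B|%:R - (#|s :&: B|.*2)%:R.
Proof.
rewrite (big_setID s) /=.
rewrite (eq_bigr (fun=> -1)) => [|i]; last by rewrite inE /sgn => /andP[_ ->].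
rewrite [X in _ + X](eq_bigr (fun=> 1)) => [|i]; last by rewrite inE /sgn => /andP[/negbTE ->].
rewrite !sumr_const (setIC s) -[in #|B|%:R](cardsID s B) -addnn !natrD mulNrn.
by ring.
Qed.

Lemma sum_sgnM i j :
  \sum_s sgn s i * sgn s j = if i == j then #|{set I}|%:R else 0.
Proof.
case: eqVneq => [->|ij].
  under eq_bigr do rewrite /sgn -expr2 sqrr_sign.
  by rewrite sumr_const.
(* Flipping the sign at i negates the sum. *)
pose h s := [set x | (x \in s) (+) (x == i)].
have hK : involutive h.
  by move=> s; apply/setP => x; rewrite !inE -addbA addbb addbF.
set S := \sum_s _; suff : S = - S by lra.
rewrite {1}/S (reindex_inj (inv_inj hK)) /S -sumrN; apply: eq_bigr => s _.
rewrite /sgn !inE eqxx (eq_sym j) (negbTE ij) addbF addbT.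
by rewrite signrN mulNr.
Qed.

(** The variance used in Chebyshev's inequality: by orthogonality of the signs only the diagonal
    terms survive. *)
Lemma sum_sqr_sum_sgn B :
  \sum_s (\sum_(i in B) sgn s i) ^+ 2 = #|B|%:R * #|{set I}|%:R.
Proof.
under eq_bigr => s _ do (rewrite expr2 big_distrlr /=).
rewrite exchange_big /=.
under eq_bigr => i _ do rewrite exchange_big /=.
under eq_bigr => i iB.
  under eq_bigr do rewrite sum_sgnM.
  rewrite -big_mkcondr /= (big_pred1 i); last first.
    by move=> j; rewrite /= andbC; case: eqVneq => // <-; rewrite iB.
  over.
by rewrite sumr_const mulr_natl.
Qed.

(** By [sum_sgn], for even [#|U|] this is the indicator that the signs in [U] do not sum to zero. *)
Definition avoids U s : R := (#|s :&: U| != #|U|./2)%:R.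

Lemma mean_splice_avoids_ge0 A U s : 0 <= mean_splice A (avoids U) s.
Proof. by rewrite divr_ge0 // sumr_ge0. Qed.

Lemma mean_splice_avoids_le1 A U s : mean_splice A (avoids U) s <= 1.
Proof.
rewrite ler_pdivrMr ?card_sets_gt0 // mul1r -[leRHS]mulr1n.
rewrite -[leRHS]mul1r mulr_natr -sumr_const; apply: ler_sum => t _; by rewrite /avoids lern1 leq_b1.
Qed.

(** Once the signs on [U :\: A] are fixed, balance on [U] means that the resampled trace on [A] has
    one prescribed size [j]. Their small sum puts [j] close to [#|A|] / 2, where [bin_lower] gives
    probability at least 1 / (8 [#|A|]^(1/2)) >= p. *)
Lemma mean_splice_avoids_le A U s (p : R) :
    A \subset U -> ~~ odd #|U| -> (5 < #|A|)%N ->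
    (\sum_(i in U :\: A) sgn s i) ^+ 2 *+ 4 <= #|A|%:R ->
    0 <= p -> 64 * #|U|%:R * p ^+ 2 <= 1 ->
  mean_splice A (avoids U) s <= 1 - p.
Proof.
move=> AU Ueven A5 good p0 pU.
pose b := #|s :&: (U :\: A)|; pose j := (#|U|./2 - b)%N.
have cU : #|U| = (#|A| + #|U :\: A|)%N.
  by rewrite -(cardsID A U) (setIidPr AU).
have eU : (#|U|./2).*2 = #|U| by rewrite even_halfK // Ueven.
have good' : ((#|U :\: A|%:Z - b.*2%:Z) ^+ 2 *+ 4 <= #|A|%:Z).
  rewrite -(ler_int R) rmorphMn rmorphXn /= rmorphB /=.
  by rewrite -sum_sgn.
(* This makes the truncated subtraction in [j] a true one: otherwise the sum over [U :\: A] would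
   exceed [#|A|] in absolute value, against [good']. *)
have bU : (b <= #|U|./2)%N.
  rewrite leqNgt; apply/negP => ub; have {ub} : (#|A| + #|U :\: A| < b.*2)%N by lia.
  move: good' A5; set x := #|A|; set y := #|U :\: A|; clearbody b x y; clear.
  rewrite expr2 => good' x5 h.
  have h1 : (x%:Z * x%:Z <= (y%:Z - b.*2%:Z) * (y%:Z - b.*2%:Z)) by nia.
  have h2 : (5%:Z * x%:Z <= x%:Z * x%:Z) by nia.
  lia.
have cj : (4 ^ #|A| <= 64 * #|A| * 'C(#|A|, j) ^ 2)%N.
  apply: bin_lower => //; apply: le_trans good'.
  by rewrite (_ : (j.*2)%:Z - _ = #|U :\: A|%:Z - b.*2%:Z) // /j; lia.
have tr t : (#|splice A s t :&: U| != #|U|./2) = (#|t :&: A| != j).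
  have -> : #|splice A s t :&: U| = (#|t :&: A| + b)%N.
    rewrite -(cardsID A (_ :&: U)); congr (_ + _)%N; apply: eq_card => i; rewrite !inE.
      by move/subsetP/(_ i): AU; case: (i \in A) => [->|_] //; rewrite ?andbT ?andbF.
    by case: (i \in A); rewrite ?andbF ?andbT //= ?orbF.
  by rewrite /j; congr negb; apply/eqP/eqP; lia.
rewrite /mean_splice /avoids; under eq_bigr => t _ do rewrite tr.
have cardC : \sum_t (#|t :&: A| != j)%:R =
    #|{set I}|%:R - #|[set t : {set I} | #|t :&: A| == j]|%:R :> R.
  rewrite -natr_sum -[X in X%:R - _](cardsC [set t : {set I} | #|t :&: A| == j]).
  rewrite natrD addrC addKr -sum1_card [in RHS]big_mkcond /=; congr (_%:R); apply: eq_bigr => t _.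
  by rewrite !inE; case: eqP.
have N0 := @card_sets_gt0 I R.
rewrite cardC mulrBl divff ?lt0r_neq0 // lerB //.
have := card_trace A j; set k := #|_| => /(congr1 (fun x => x%:R : R)).
rewrite !natrM natrX => ek.
have P0 : 0 < 2 ^+ #|A| :> R by rewrite exprn_gt0.
have -> : k%:R / #|{set I}|%:R = 'C(#|A|, j)%:R / 2 ^+ #|A| :> R.
  by apply/eqP; rewrite eqr_div ?lt0r_neq0 // ek.
rewrite ler_pdivlMr // -(@ler_pXn2r _ 2) ?nnegrE ?mulr_ge0 ?(ltW P0) //.
rewrite exprMn -exprM mulnC exprM (_ : 2 ^+ 2 = 4%:R); last by rewrite -natrX.
move: cj; rewrite -(ler_nat R) !natrM !natrX => cj.
have AU' : #|A|%:R <= #|U|%:R :> R by rewrite ler_nat cU leq_addr.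
have c0 : 0 <= 'C(#|A|, j)%:R ^+ 2 :> R by rewrite exprn_ge0.
apply: le_trans (ler_wpM2l _ cj) _; first by rewrite exprn_ge0.
rewrite mulrCA mulrA -[leRHS]mul1r ler_wpM2r //.
apply: le_trans pU; rewrite ler_wpM2r ?exprn_ge0 //.
by rewrite ler_wpM2l.
Qed.

End SignSums.

(** An algebraic substitute for bounding the product of the 1 - c_j by exp(- sum c_j). Each factor
    is absorbed by (1 - c)(1 + c + S) <= 1 + S. *)
Lemma prod_mul_sum_le1 (R : realFieldType) (J : finType) (x c : J -> R) :
    (forall j, 0 <= x j <= 1 - c j) -> (forall j, 0 <= c j) ->
  (\prod_j x j) * (1 + \sum_j c j) <= 1.
Proof.
move=> xc c0.
suff [_ _] : [/\ 0 <= \prod_j x j, 0 <= \sum_j c j &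
  (\prod_j x j) * (1 + \sum_j c j) <= 1] by [].
elim/big_rec2: _ => [|j S P _ [P0 S0 PS]]; first by rewrite addr0 mulr1.
have /andP[x0 xle] := xc j; have cj := c0 j; split; first exact: mulr_ge0.
  exact: addr_ge0.
have h1 : x j * (1 + (c j + S)) <= 1 + S.
  apply: (@le_trans _ _ ((1 - c j) * (1 + (c j + S)))).
    by rewrite ler_wpM2r // !addr_ge0.
  by nra.
by apply: le_trans PS; rewrite -mulrA mulrCA ler_wpM2l.
Qed.

(** By Chebyshev each index is bad with probability at most 4b/M, so by Markov at least half of them
    are bad with probability at most 8b/M. Otherwise the good ones contribute at least p [#|J|] / 2
    to the sum in [prod_mul_sum_le1], which gives the second term. *)
Lemma card_avoiding_le (R : realFieldType) (I J : finType)
    (A U : J -> {set I}) (T b M : nat) (p : R) :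
    (forall j, A j \subset U j) -> (forall j, #|U j| = T) -> ~~ odd T ->
    (forall j, #|U j :\: A j| <= b)%N -> (M + b)%N = T -> (5 < M)%N ->
    (forall i j, i != j -> [disjoint A i & U j]) ->
    0 < p -> 64 * T%:R * p ^+ 2 <= 1 -> (0 < #|J|)%N ->
  #|[set s : {set I} | [forall j, #|s :&: U j| != T./2]]|%:R / #|{set I}|%:R
    <= 8 * b%:R / M%:R + 2 / (p * #|J|%:R).
Proof.
move=> AU UT Teven Bb MbT M5 dAU p0 pT J0.
have N0 := @card_sets_gt0 I R; set N := #|{set I}|%:R in N0 *.
have MA j : (M <= #|A j|)%N.
  have := cardsID (A j) (U j); rewrite (setIidPr (AU j)) UT => e.
  by have := Bb j; lia.
have dAA i j : i != j -> [disjoint A i & A j].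
  by move=> ij; apply: disjointWr (AU j) (dAU i j ij).
pose dev j s : R := \sum_(i in U j :\: A j) sgn R s i.
pose bad j s := ~~ (dev j s ^+ 2 *+ 4 <= M%:R).
pose nbad s : R := \sum_j (bad j s)%:R.
set r : R := #|J|%:R; have r0 : 0 < r by rewrite ltr0n.
have M0 : 0 < M%:R :> R by rewrite ltr0n; lia.
have count_avoid : #|[set s : {set I} | [forall j, #|s :&: U j| != T./2]]|%:R =
    \sum_s \prod_j avoids R (U j) s.
  rewrite -sum1_card natr_sum big_mkcond /=; apply: eq_bigr => s _.
  rewrite inE; case: forallP => [h|/forallP].
    by rewrite big1 // => j _; rewrite /avoids UT h.
  rewrite negb_forall => /existsP[j]; rewrite negbK => /eqP ej.
  by rewrite (bigD1 j) //= /avoids UT ej eqxx mul0r.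
have bad_sum j : \sum_s (bad j s)%:R <= N * (4 * b%:R / M%:R).
  have : \sum_s (bad j s)%:R * M%:R <= \sum_s dev j s ^+ 2 *+ 4.
    apply: ler_sum => s _; rewrite /bad; have [h|h] /= := lerP (dev j s ^+ 2 *+ 4) M%:R.
      by rewrite mul0r mulrn_wge0 // sqr_ge0.
    by rewrite mul1r ltW.
  rewrite -mulr_suml sumrMnl sum_sqr_sum_sgn => h.
  rewrite mulrA ler_pdivlMr //; apply: le_trans h _; rewrite -/N.
  have : #|U j :\: A j|%:R * N <= b%:R * N by rewrite ler_wpM2r ?ler_nat // ltW.
  lra.
(* Both cases in one bound: the first term is at least 1 when half of the indices are bad, and the
   second suffices when fewer are. *)
have pointwise s : \prod_j mean_splice (A j) (avoids R (U j)) s <=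
    2 / r * nbad s + 2 / (p * r).
  set P := \prod_j _.
  have P1 : P <= 1.
    by apply: prodr_ile1 => j _; rewrite mean_splice_avoids_ge0 mean_splice_avoids_le1.
  have P0 : 0 <= P by apply: prodr_ge0 => j _; exact: mean_splice_avoids_ge0.
  have nb0 : 0 <= nbad s by apply: sumr_ge0.
  have [many|few] := lerP r (2 * nbad s).
    apply: (le_trans P1); rewrite -[leLHS]addr0; apply: lerD.
      by rewrite mulrAC ler_pdivlMr // mul1r.
    by rewrite divr_ge0 // mulr_ge0 // ltW.
  have : P * (1 + \sum_j p * (~~ bad j s)%:R) <= 1.
    apply: prod_mul_sum_le1 => j; last by rewrite mulr_ge0 // ltW.
    rewrite mean_splice_avoids_ge0 /=; case: (boolP (bad j s)) => /= h.
      by rewrite mulr0 subr0 mean_splice_avoids_le1.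
    rewrite mulr1; apply: mean_splice_avoids_le; rewrite ?UT ?(ltW p0) //.
      exact: leq_trans (MA j).
    by move: h; rewrite negbK => /le_trans -> //; rewrite ler_nat.
  have eg : \sum_j (~~ bad j s)%:R = r - nbad s.
    rewrite /r /nbad -sum1_card natr_sum -sumrB; apply: eq_bigr => j _.
    by case: (bad j s); rewrite ?subrr ?subr0.
  rewrite -mulr_sumr eg => h.
  have h2 : P * (p * r) <= 2.
    have : P * (p * (r - 2 * nbad s)) >= 0 by rewrite !mulr_ge0 // ?subr_ge0 ltW.
    by nra.
  apply: (@le_trans _ _ (2 / (p * r))); first by rewrite ler_pdivlMr // mulr_gt0.
  by rewrite lerDr mulr_ge0 // divr_ge0 // ltW.
rewrite count_avoid ler_pdivrMr // (sum_prod_mean_splice dAA); last first.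
  move=> i j s t ij; rewrite /avoids splice_setI //.
  by apply: dAU; rewrite eq_sym.
apply: le_trans (ler_sum _ (fun s _ => pointwise s)) _.
rewrite big_split /= -mulr_sumr sumr_const -[_ *+ #|_|]mulr_natl /nbad exchange_big /=.
have : \sum_j \sum_s (bad j s)%:R <= \sum_(j : J) N * (4 * b%:R / M%:R).
  by apply: ler_sum.
rewrite sumr_const -[_ *+ #|_|]mulr_natl -/r => h.
rewrite [leRHS]mulrDl (mulrC (2 / (p * r)) N) lerD2r.
apply: le_trans (ler_wpM2l _ h) _; first by rewrite divr_ge0 // ltW.
rewrite le_eqVlt; apply/orP; left; apply/eqP.
by field; rewrite !lt0r_neq0.
Qed.

(** * Sign forms at 0/1 points *)

Module SignForms.
Import mpoly.

Definition vars n (m : 'X_{1..n}) : {set 'I_n} := [set i | m i != 0%N].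

(** The monomials of degree [d] with value 1 at the 0/1 point of [S]; all others of that degree
    vanish there. *)
Definition monomials d n (S : {set 'I_n}) : {set 'X_{1..n < d.+1}} :=
  [set m | (mdeg (bmnm m) == d) && (vars m \subset S)].

Lemma sum_vars n (m : 'X_{1..n}) (S : {set 'I_n}) :
  vars m \subset S -> (\sum_(i in S) m i = mdeg m)%N.
Proof.
move=> /subsetP mS; rewrite mdegE [RHS](bigID (mem S)) /= [X in (_ + X)%N]big1 ?addn0 //.
by move=> i iS; apply: contraNeq iS => mi; apply: mS; rewrite inE.
Qed.

(** Stars and bars: reading the exponents along an enumeration [sg] of [S] gives a bijection with
    the (k+1)-tuples of sum [d]. *)
Lemma card_monomials d n (S : {set 'I_n}) k : #|S| = k.+1 ->
  #|monomials d S| = 'C(k + d, k).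
Proof.
move=> Sk; rewrite -card_ord_partitions.
pose sg (i : 'I_k.+1) : 'I_n := enum_val (cast_ord (esym Sk) i).
have sgS i : sg i \in S by exact: enum_valP.
have sum_sg (F : 'I_n -> nat) : (\sum_(i in S) F i = \sum_i F (sg i))%N.
  rewrite big_enum_val (reindex (cast_ord (esym Sk))) //.
  by exists (cast_ord Sk) => i _; rewrite ?cast_ordK ?cast_ordKV.
have le_d (m : 'X_{1..n < d.+1}) i : (bmnm m i <= d)%N.
  by rewrite -ltnS (leq_ltn_trans _ (bmdeg m)) // mdegE (bigD1 i) //= leq_addr.
pose f (m : 'X_{1..n < d.+1}) := [tuple inord (bmnm m (sg i)) : 'I_d.+1 | i < k.+1].
have f_inj : {in monomials d S &, injective f}.
  move=> m m'; rewrite !inE => /andP[_ mS] /andP[_ m'S] e.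
  apply/val_inj/mnmP => x /=; have [xS|xS] := boolP (x \in S); last first.
    have z (u : 'X_{1..n < d.+1}) : vars u \subset S -> bmnm u x = 0%N.
      by move/subsetP/(_ x); rewrite inE; case: eqP => // _ /(_ isT); rewrite (negbTE xS).
    by rewrite !z.
  have [i ->] : exists i, x = sg i.
    by exists (cast_ord Sk (enum_rank_in xS x)); rewrite /sg cast_ordK enum_rankK_in.
  have /(congr1 val) := congr1 (fun t => tnth t i) e.
  by rewrite !tnth_mktuple /= !inordK // ltnS.
rewrite -(card_in_imset f_inj); apply: eq_card => t; rewrite inE.
apply/imsetP/eqP => [[m]|tsum].
  rewrite inE => /andP[/eqP md mS] ->; rewrite -[RHS]md -(sum_vars mS) sum_sg big_tuple.
  by apply: eq_bigr => i _; rewrite tnth_mktuple inordK // ltnS.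
(* The inner sum is empty for x outside [S] and has a single term for x in [S], since [sg] is
   injective. *)
pose m : 'X_{1..n} := [multinom (\sum_(i < k.+1 | sg i == x) tnth t i)%N | x < n].
have msg i : m (sg i) = tnth t i.
  rewrite mnmE (big_pred1 i) // => i' /=; rewrite (inj_eq _) //.
  by move=> x y /enum_val_inj/cast_ord_inj.
have mS : vars m \subset S.
  apply/subsetP => x; rewrite inE mnmE; apply: contraNT => xS.
  by rewrite big1 // => i /eqP si; rewrite -si sgS in xS.
have md : mdeg m = d.
  by rewrite -(sum_vars mS) sum_sg -[RHS]tsum big_tuple; apply: eq_bigr => i _.
have mlt : (mdeg m < d.+1)%N by rewrite md.
exists (BMultinom mlt); first by rewrite inE /= md eqxx.
by apply: eq_from_tnth => i; apply: val_inj; rewrite tnth_mktuple /= inordK msg // ltn_ord.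
Qed.

Definition full_monomials d n (S : {set 'I_n}) : {set 'X_{1..n < d.+1}} :=
  [set m | (mdeg (bmnm m) == d) && (vars m == S)].

Lemma full_monomials_sub d n (S : {set 'I_n}) :
  full_monomials d S \subset monomials d S.
Proof. by apply/subsetP => m; rewrite !inE => /andP[-> /eqP->] /=. Qed.

(** Union bound over a variable of [S] that the monomial misses. *)
Lemma card_partial_monomials d n (S : {set 'I_n}) k : #|S| = k.+2 ->
  (#|monomials d S :\: full_monomials d S| <= k.+2 * 'C(k + d, k))%N.
Proof.
move=> Sk; have sub : monomials d S :\: full_monomials d S
    \subset \bigcup_(i in S) monomials d (S :\ i).
  apply/subsetP => m; rewrite !inE => /andP[+ /andP[md mS]].
  rewrite md /= eqEsubset mS => /subsetPn[i iS im].
  apply/bigcupP; exists i => //; rewrite inE md; apply/subsetP => x xm.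
  by rewrite in_setD1 (subsetP mS) // andbT; apply: contraNneq im => <-.
apply: (leq_trans (subset_leq_card sub)).
have union_bound : (#|\bigcup_(i in S) monomials d (S :\ i)|
    <= \sum_(i in S) #|monomials d (S :\ i)|)%N.
  elim/big_rec2: _ => [|i B x _ IH]; first by rewrite cards0.
  by apply: leq_trans (leq_card_setU _ _) _; rewrite leq_add2l.
apply: (leq_trans union_bound); rewrite -Sk -sum_nat_const leq_sum // => i iS.
by rewrite (@card_monomials _ _ _ k) //; have := cardsD1 i S; rewrite iS Sk; lia.
Qed.

(** A support equal to [S] and contained in [S'] forces [S] = [S'] by cardinality. Hence resampling
    the block of [S] does not change the value at the point of any other set. *)
Lemma full_monomials_disjoint d n (S S' : {set 'I_n}) : #|S| = #|S'| -> S != S' ->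
  [disjoint full_monomials d S & monomials d S'].
Proof.
move=> e SS'; apply/pred0P => m /=; rewrite !inE; apply/negP.
case/andP=> /andP[_ /eqP mS] /andP[_ mS']; case/negP: SS'.
by rewrite eqEcard -{1}mS mS' e /=.
Qed.

Lemma dhomog_mevalZ (R : comNzRingType) n d (p : {mpoly R[n]}) (a : R) (v : 'I_n -> R) :
  p \is d.-homog -> p.@[fun i => a * v i] = a ^+ d * p.@[v].
Proof.
move=> hp; rewrite !mevalE big_distrr /= !big_seq; apply: eq_bigr => m mp.
have md : mdeg m = d := dhomog_mf hp mp.
rewrite mulrCA -md mdegE -prodrXr -big_split /=; congr (_ * _).
by apply: eq_bigr => i _; rewrite exprMn.
Qed.

(** Double counting of the pairs (t, v) with [g t] = v. *)
Lemma card_imfset_fibres (T : finType) (V : choiceType) (g : T -> V) h (P : pred V) :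
    (forall t, #|[set u | g u == g t]| = h) ->
  #|[set t | P (g t)]| = (#|` [fset v in [fset g t | t : T] | P v]%fset| * h)%N.
Proof.
move=> gh; set X := [fset v in _ | _]%fset.
have XP t : (g t \in X) = P (g t) by rewrite !inE in_imfset.
rewrite -sum1_card big_mkcond /=.
transitivity (\sum_t \sum_(v <- X) (g t == v))%N.
  apply: eq_bigr => t _; rewrite inE -XP; case: ifP => tX.
    rewrite (bigD1_seq (g t)) ?fset_uniq //= eqxx big1 // => v.
    by rewrite eq_sym => /negbTE ->.
  by rewrite big_seq big1 // => v vX; case: eqP => // e; rewrite -e tX in vX.
rewrite exchange_big /= big_seq (eq_bigr (fun=> h)) -?big_seq => [|v].
  by rewrite big_const_seq count_predT iter_addn_0 mulnC.
rewrite !inE /= => /andP[/imfsetP[/= t _ ->] _]; rewrite -(gh t) -sum1_card big_mkcond.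
by rewrite [RHS]big_mkcond; apply: eq_bigr => u _; rewrite inE; case: eqP.
Qed.

Lemma card_sign_fibre (I : finType) (V : eqType) (g : {set I} -> V) (D : pred I) :
    (forall s t, g s = g t <->
       exists b, forall m, D m -> (m \in s) = (m \in t) (+) b) ->
  forall s, #|[set u | g u == g s]| = #|[set u | g u == g set0]|.
Proof.
move=> gP s.
suff le t t' : (#|[set u | g u == g t]| <= #|[set u | g u == g t']|)%N.
  by apply: anti_leq; rewrite !le.
(* Adding t + t' modulo 2 maps the fibre of g t into that of g t'. *)
pose x (u : {set I}) : {set I} := [set m | (m \in u) (+) ((m \in t) (+) (m \in t'))].
have x_inj : injective x.
  by move=> u v /setP e; apply/setP => m; have := e m; rewrite !inE => /addIb.
rewrite -(card_imset _ x_inj); apply/subset_leq_card/subsetP => v /imsetP[u].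
rewrite !inE => /eqP/gP[b ub] ->.
apply/eqP/gP; exists b => m Dm; rewrite inE ub //.
by case: (m \in t); case: (m \in t'); case: b {ub}.
Qed.

Section Hypersurfaces.
Variables d n : nat.
Let I : finType := 'X_{1..n.+1 < d.+1}.
Implicit Types (s t u : {set I}).

Definition set_form s : {mpoly rat[n.+1]} :=
  sign_form [ffun m : 'X_{1..n.+1 < d.+1} => m \in s].

Definition set_hypersurface s := [fset set_form s; - set_form s]%fset.

Lemma hypersurfacesE : hypersurfaces d n = [fset set_hypersurface s | s : {set I}]%fset.
Proof.
apply/fsetP => V; apply/imfsetP/imfsetP => /=.
  move=> [F /imfsetP[/= s _ ->] ->]; exists [set m | s m]; first by rewrite inE.
  have e : sign_form s = set_form [set m | s m].
    by congr sign_form; apply/ffunP => m; rewrite ffunE inE.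
  by rewrite /set_hypersurface e.
move=> [s _ ->]; exists (set_form s); last by [].
by apply/imfsetP; exists [ffun m : 'X_{1..n.+1 < d.+1} => m \in s].
Qed.

Lemma set_formP (b : bool) s t :
  (set_form s = (-1) ^+ b *: set_form t) <->
  (forall m : I, mdeg (bmnm m) = d -> (m \in s) = (m \in t) (+) b).
Proof.
split=> [e m md|e].
  have := congr1 (fun p => p@_m) e; rewrite mcoeffZ !sign_formE md eqxx !ffunE -signr_addb.
  by case: (m \in s); case: (m \in t); case: b {e} => //= h; exfalso; move: h; lra.
apply/mpolyP => m; rewrite mcoeffZ; have [md|md] := eqVneq (mdeg m) d; last first.
  by rewrite !(dhomog_nemf_coeff (sign_form_homog _) md) mulr0.
have lm : (mdeg m < d.+1)%N by rewrite md.
rewrite !(sign_formE _ (BMultinom lm)) md eqxx !ffunE -signr_addb.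
by rewrite e // addbC.
Qed.

Lemma set_hypersurfaceP s t :
  set_hypersurface s = set_hypersurface t <->
  exists b : bool, forall m : I, mdeg (bmnm m) = d -> (m \in s) = (m \in t) (+) b.
Proof.
split=> [e|[b]].
  have /fset2P[h|h] : set_form s \in set_hypersurface t by rewrite -e fset21.
    by exists false; apply/set_formP; rewrite scale1r.
  by exists true; apply/set_formP; rewrite scaleN1r.
case: b => /set_formP; rewrite ?scaleN1r ?scale1r /set_hypersurface => ->; last reflexivity.
rewrite (opprK (set_form t)); exact: fsetUC.
Qed.

(** The overall sign and the choices at monomials of degree below [d] do not affect the
    hypersurface, so each one arises from equally many sets and the ratio is a probability for a
    uniform set [s]. *)
Lemma soluble_ratioE :
  soluble_ratio d n =
  #|[set s : {set I} | boolp.asbool (soluble (set_hypersurface s))]|%:R / #|{set I}|%:R.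
Proof.
rewrite /soluble_ratio hypersurfacesE.
move: set_hypersurface set_hypersurfaceP => g gP.
have gP' s t : g s = g t <-> exists b, forall m : I,
    (mdeg (bmnm m) == d) -> (m \in s) = (m \in t) (+) b.
  rewrite gP; split=> -[b h]; exists b => m; last by move/eqP; apply: h.
  by move/eqP; apply: h.
have fib := card_imfset_fibres _ (card_sign_fibre gP').
set h := #|[set u | g u == g set0]| in fib.
have h0 : (0 < h)%N by apply/card_gt0P; exists set0; rewrite inE.
rewrite (fib (fun V => boolp.asbool (soluble V))).
rewrite -[X in _ = _ / X%:R]cardsT (_ : [set: {set I}] = [set s | xpredT (g s)]).
  rewrite (fib xpredT) !natrM -mulf_div divff ?mulr1 ?pnatr_eq0 -?lt0n //.
  by congr (_ / #|` _|%:R); apply/fsetP => V; rewrite !inE /= andbT.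
by apply/setP => s; rewrite !inE.
Qed.

Lemma meval_set_form s (S : {set 'I_n.+1}) :
  (set_form s).@[fun i => (i \in S)%:R] = \sum_(m in monomials d S) sgn rat s m.
Proof.
rewrite /set_form /sign_form raddf_sum /= [LHS]big_mkcond [RHS]big_mkcond /=.
apply: eq_bigr => m _; rewrite inE; case: eqP => //= _; rewrite mevalZ mevalX ffunE.
case: ifPn => [mS|/subsetPn[i]].
  rewrite big1 ?mulr1 // => i _; have [iS|iS] := boolP (i \in S); first by rewrite expr1n.
  suff -> : bmnm m i = 0%N by rewrite expr0.
  by apply/eqP; apply: contraNT iS => mi; rewrite (subsetP mS) // inE.
rewrite inE => mi /negbTE iS.
by rewrite (bigD1 i) //= iS expr0n (negbTE mi) mul0r mulr0.
Qed.

Lemma soluble_set_hypersurface s (S : {set 'I_n.+1}) :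
  S != set0 -> (set_form s).@[fun i => (i \in S)%:R] = 0 -> soluble (set_hypersurface s).
Proof.
move=> /set0Pn[i0 i0S] s0; pose x : 'rV[rat]_n.+1 := \row_i (i \in S)%:R.
have x0 : x != 0.
  by apply/eqP => /rowP/(_ i0)/eqP; rewrite !mxE i0S oner_eq0.
exists <[x]>%VS; split; first by rewrite dim_vline x0.
have vanish a : (set_form s).@[fun i => (a *: x) ord0 i] = 0.
  rewrite (@meval_eq _ _ _ (fun i => a * (i \in S)%:R)) => [|i]; last by rewrite !mxE.
  by rewrite (dhomog_mevalZ _ _ (sign_form_homog _)) s0 mulr0.
move=> F y + /vlineP[a ->]; rewrite in_fset2 => /orP[]/eqP-> //.
by rewrite mevalN vanish oppr0.
Qed.

End Hypersurfaces.

Lemma soluble_of_balanced d n (S : {set 'I_n.+1}) (s : {set 'X_{1..n.+1 < d.+1}}) :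
    S != set0 -> ~~ odd #|monomials d S| ->
    #|s :&: monomials d S| = #|monomials d S|./2 ->
  soluble (set_hypersurface s).
Proof.
move=> S0 ev h; apply: (soluble_set_hypersurface S0).
by rewrite meval_set_form sum_sgn h even_halfK ?subrr.
Qed.

Lemma dist_soluble_ratio (R : realFieldType) d n :
  `|ratr (soluble_ratio d n) - 1| =
  #|[set s : {set 'X_{1..n.+1 < d.+1}} |
      ~~ boolp.asbool (soluble (set_hypersurface s))]|%:R
  / #|{set 'X_{1..n.+1 < d.+1}}|%:R :> R.
Proof.
rewrite soluble_ratioE; set X := [set s | _]; set Y := [set s | ~~ _].
have -> : Y = ~: X by apply/setP => s; rewrite !inE.
have N0 := @card_sets_gt0 'X_{1..n.+1 < d.+1} R.
rewrite fmorph_div /= !ratr_nat; set N : R := #|{set _}|%:R in N0 *.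
have e : N = #|X|%:R + #|~: X|%:R by rewrite -natrD cardsC.
have -> : #|X|%:R / N - 1 = - (#|~: X|%:R / N).
  by apply: (mulIf (lt0r_neq0 N0)); rewrite mulrBl mulNr !divfK ?lt0r_neq0 // mul1r e; ring.
by rewrite normrN ger0_norm // divr_ge0 // ltW.
Qed.

(** The points tested are indexed by all sets [S] of k + 2 variables, with K = k + 1. An insoluble
    hypersurface is unbalanced at every one of them, so [card_avoiding_le] applies. *)
Lemma soluble_ratio_bound (R : realFieldType) d n k (p : R) :
    let T := 'C(k.+1 + d, k.+1) in let b := (k.+2 * 'C(k + d, k))%N in
    ~~ odd T -> (b + 5 < T)%N -> 0 < p -> 64 * T%:R * p ^+ 2 <= 1 -> (k < n)%N ->
  `|ratr (soluble_ratio d n) - 1| <=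
    8 * b%:R / (T - b)%:R + 2 / (p * 'C(n.+1, k.+2)%:R).
Proof.
move=> T b Tev bT p0 pT kn.
pose J : finType := {S : {set 'I_n.+1} | #|S| == k.+2}.
have JS (j : J) : #|val j| = k.+2 by exact/eqP/(valP j).
have cJ : #|J| = 'C(n.+1, k.+2).
  by rewrite card_sig -[n.+1 in RHS]card_ord -card_draws cardsE.
rewrite dist_soluble_ratio -cJ.
pose U (j : J) := monomials d (val j); pose A (j : J) := full_monomials d (val j).
have UT (j : J) : #|U j| = T by exact/card_monomials/JS.
apply: le_trans (@card_avoiding_le R _ J A U T b (T - b)%N p _ UT Tev _ _ _ _ p0 pT _).
- rewrite ler_wpM2r ?invr_ge0 // ler_nat subset_leq_card //; apply/subsetP => s.
  rewrite !inE; apply: contraNT => /forallPn[j]; rewrite negbK => /eqP js.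
  apply/boolp.asboolP/(@soluble_of_balanced _ _ (val j)); rewrite -/(U j) ?UT //.
  by rewrite -card_gt0 JS.
- by move=> j; exact: full_monomials_sub.
- by move=> j; exact/card_partial_monomials/JS.
- by rewrite subnK //; lia.
- by lia.
- move=> i j ij; apply: full_monomials_disjoint; first by rewrite !JS.
  by rewrite (inj_eq val_inj).
by rewrite cJ bin_gt0; lia.
Qed.

End SignForms.

(** The constant is 24 = 8 + 16: the first term is at most 8 d^(-1/2) by [bq], and with p = 1 / (8
    T^(1/2)) the second equals 16 T^(1/2) / r, which is at most 16 d^(-1/2) by [r2]. *)
Lemma soluble_ratio_sqrt (R : rcfType) d n :
    let K := (2 ^ logn 2 d)%N in
    (16 ^ K.+1 <= d)%N -> 2 * K.+1%:R * Num.sqrt d%:R <= n%:R :> R ->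
  `|ratr (soluble_ratio d n) - 1| <= 24 / Num.sqrt d%:R :> R.
Proof.
move=> K dK nK; have K0 : (0 < K)%N by rewrite expn_gt0.
have d256 : (256 <= d)%N by apply: leq_trans dK; rewrite (_ : 256 = 16 ^ 2)%N // leq_exp2l.
have [k eK] : exists k, k.+1 = K by exists K.-1; rewrite prednK.
have n2 : (4 * d * K.+1 ^ 2 <= n ^ 2)%N.
  rewrite -(ler_nat R) (natrM _ (4 * d)) (natrM _ 4) !natrX.
  have -> : 4 * d%:R * K.+1%:R ^+ 2 = (2 * K.+1%:R * Num.sqrt d%:R) ^+ 2 :> R.
    by rewrite !exprMn sqr_sqrtr //; ring.
  by rewrite ler_pXn2r ?nnegrE ?mulr_ge0 ?sqrtr_ge0.
have Kn : (K <= n)%N by rewrite -(leq_exp2r _ _ (isT : 0 < 2)%N); nia.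
have r2 := binom_sqr_ge K0 (leq_trans (isT : 0 < 256)%N d256) n2.
have Tev := even_bin_pow2 (leq_trans (isT : 0 < 256)%N d256) eK.
set T := 'C(K + d, K) in r2; set r := 'C(n.+1, K.+1) in r2.
pose b := (K.+1 * 'C(k + d, k))%N.
(* So b/T is exactly K(K+1)/(K+d). *)
have bT : (b * (K + d) = K * K.+1 * T)%N.
  by rewrite /b /T -eK (mulnC k.+1) -(mulnA k.+2 k.+1) mul_binS; ring.
pose q : R := Num.sqrt d%:R; have q16 : 16 <= q.
  rewrite -(@ler_pXn2r _ 2) ?nnegrE ?sqrtr_ge0 // sqr_sqrtr // -natrX ler_nat //.
have q2 : q ^+ 2 = d%:R by rewrite sqr_sqrtr.
have KKq : 2 * (K * K.+1)%:R <= q.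
  rewrite -(@ler_pXn2r _ 2) ?nnegrE ?mulr_ge0 ?sqrtr_ge0 // q2 exprMn -!natrX -natrM ler_nat.
  exact: exp16_ge.
have Td : (d < T)%N.
  rewrite /T -bin_sub ?leq_addr // addKn; apply: leq_trans (leq_bin2l d (_ : d.+1 <= K + d)%N).
    by rewrite binSn.
  by lia.
have T0 : 0 < T%:R :> R by rewrite ltr0n; lia.
have bq : 2 * b%:R * q <= T%:R :> R.
  have e : b%:R * (K%:R + d%:R) = (K * K.+1)%:R * T%:R :> R by rewrite -natrD -!natrM bT.
  have h1 : b%:R * d%:R <= (K * K.+1)%:R * T%:R :> R.
    by rewrite -e ler_wpM2l // lerDr.
  have h2 : 2 * (K * K.+1)%:R * T%:R <= q * T%:R by rewrite ler_wpM2r // ltW.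
  rewrite -(@ler_pM2r _ q); last by lra.
  rewrite (_ : 2 * b%:R * q * q = 2 * (b%:R * d%:R)); last by rewrite -q2; ring.
  lra.
have bT32 : (32 * b <= T)%N.
  rewrite -(ler_nat R) natrM; apply: le_trans bq.
  have : 0 <= b%:R * (q - 16) by rewrite mulr_ge0 // subr_ge0.
  lra.
have b5 : (b + 5 < T)%N by move: bT32 Td d256; clear; clearbody b T; lia.
pose p : R := (8 * Num.sqrt T%:R)^-1.
have s0 : 0 < Num.sqrt T%:R :> R by rewrite sqrtr_gt0.
have p0 : 0 < p by rewrite invr_gt0 mulr_gt0.
rewrite eK in Tev; have := @SignForms.soluble_ratio_bound R d n k p; rewrite eK => /(_ Tev) main.
apply: le_trans (main _ p0 _ Kn) _; rewrite -/b -/T.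
- exact: b5.
- have sT : Num.sqrt T%:R ^+ 2 = T%:R :> R by rewrite sqr_sqrtr // ltW.
  rewrite /p exprVn exprMn sT le_eqVlt; apply/orP; left; apply/eqP.
  by field; rewrite lt0r_neq0.
have -> : 24 / q = 8 / q + 16 / q by rewrite -mulrDl; congr (_ / _); ring.
have q0 : 0 < q by lra.
apply: lerD.
  have Tb : 0 < (T - b)%:R :> R by rewrite ltr0n subn_gt0; move: b5; clear; clearbody b T; lia.
  rewrite -mulrA ler_wpM2l // ler_pdivrMr //; rewrite mulrC ler_pdivlMr //.
  rewrite natrB; last by move: b5; clear; clearbody b T; lia.
  have : 0 <= b%:R * (q - 2) by rewrite mulr_ge0 // subr_ge0; lra.
  have : 2 * b%:R <= T%:R :> R by rewrite -natrM ler_nat; move: bT32; clear; clearbody b T; lia.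
  lra.
have r0 : 0 < r%:R :> R by rewrite ltr0n bin_gt0.
rewrite ler_pdivrMr ?mulr_gt0 // /p.
have rs : q * Num.sqrt T%:R <= r%:R :> R.
  rewrite -(@ler_pXn2r _ 2) ?nnegrE ?mulr_ge0 ?sqrtr_ge0 ?ler0n //.
  by rewrite exprMn q2 sqr_sqrtr ?(ltW T0) // -natrM -(natrX _ r 2) ler_nat mulnC.
rewrite (_ : 16 / q * _ = 2 * (r%:R / (q * Num.sqrt T%:R))); last first.
  by field; rewrite !lt0r_neq0.
by rewrite -[leLHS]mulr1 ler_wpM2l // ler_pdivlMr ?mul1r // mulr_gt0.
Qed.

(** * Density *)

From mathcomp Require Import all_classical all_reals all_analysis.
Import Order.TTheory GRing.Theory Num.Theory.
Import numFieldNormedType.Exports.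
Local Open Scope classical_set_scope.
Local Open Scope ring_scope.

(* The base 16 makes ln d >= 2 (K + 1), with K = 2 ^ logn 2 d. *)
Definition tame : pred nat := fun d => (16 ^ (2 ^ logn 2 d).+1 <= d)%N.

(** A number that is not tame either has 2-adic valuation at most [w], and is then below the first
    term, or is divisible by 2^w. *)
Lemma count_compl_tame w X :
  (count (predC tame) (iota 1 X) <= 16 ^ (2 ^ w).+1 + X %/ 2 ^ w)%N.
Proof.
have small K : (count (fun d => d < K)%N (iota 1 X) <= K)%N.
  rewrite -size_filter -[leqRHS](size_iota 0) uniq_leq_size ?filter_uniq ?iota_uniq //.
  by move=> x; rewrite mem_filter !mem_iota => /andP[].
have mult : count (fun d => 2 ^ w %| d)%N (iota 1 X) = (X %/ 2 ^ w)%N.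
  by rewrite divn_count_dvd -sum1_count big_mkcond /index_iota subn1.
rewrite -mult; apply: leq_trans (leq_add (small _) (leqnn _)).
rewrite -count_predUI; apply: leq_trans (leq_addr _ _).
apply: sub_count => x; rewrite /= /tame -ltnNge => xlt.
have [xw|xw] := leqP (logn 2 x) w; apply/orP.
  by left; apply: leq_trans xlt _; rewrite leq_exp2l // ltnS leq_exp2l.
(* [sub_count] ranges over all x; since [logn 2 0] is 0, the number 0 belongs to the previous
   case. *)
have x0 : (0 < x)%N by case: x xw {xlt} => //; rewrite logn0.
by right; rewrite pfactor_dvdn // ltnW.
Qed.

Lemma density_tame (R : realType) :
  (fun X : nat => (count tame (iota 1 X))%:R / X%:R : R) @ \oo --> (1 : R).
Proof.
(* This [w] satisfies 2/e < w < 2^w, so multiples of 2^w cost at most half of e; the constant term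
   takes the other half for large X. *)
apply/cvgrPdist_le => e e0; pose w := Num.bound (2 / e).
have ew : (2 ^ w)%:R^-1 <= e / 2.
  rewrite -[leRHS]invf_div lef_pV2 ?posrE ?divr_gt0 ?ltr0n ?expn_gt0 //.
  apply: le_trans (ltW (archi_boundP _)) _; first by rewrite divr_ge0 // ltW.
  by rewrite ler_nat ltnW // ltn_expl.
pose K := (16 ^ (2 ^ w).+1)%N.
near=> X.
have X0 : 0 < X%:R :> R by near: X; exact: nbhs_infty_gtr.
have KX : K%:R / X%:R <= e / 2.
  rewrite ler_pdivrMr // mulrC -ler_pdivrMr ?divr_gt0 //.
  by near: X; exact: nbhs_infty_ger.
have cX : X%:R = (count tame (iota 1 X))%:R + (count (predC tame) (iota 1 X))%:R :> R.
  by rewrite -natrD count_predC size_iota.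
have -> : 1 - (count tame (iota 1 X))%:R / X%:R = (count (predC tame) (iota 1 X))%:R / X%:R :> R.
  by apply: (mulIf (lt0r_neq0 X0)); rewrite mulrBl !divfK ?lt0r_neq0 // mul1r {1}cX addrC addKr.
rewrite ger0_norm ?divr_ge0 //.
have := count_compl_tame w X; rewrite -/K -(ler_nat R) natrD => h.
have dX : (X %/ 2 ^ w)%:R <= X%:R * (2 ^ w)%:R^-1 :> R.
  by rewrite ler_pdivlMr ?ltr0n ?expn_gt0 // -natrM ler_nat leq_trunc_div.
have dX2 : X%:R * (2 ^ w)%:R^-1 <= X%:R * (e / 2) by rewrite ler_wpM2l // ltW.
rewrite ler_pdivrMr //; apply: le_trans h _.
move: KX; rewrite ler_pdivrMr // => KX; lra.
Unshelve. all: by end_near.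
Qed.

(** From ln(1 + x) <= x at x = -1/2. It yields ln 16 >= 2. *)
Lemma ln2_ge_half (R : realType) : 2^-1 <= ln 2 :> R.
Proof.
have := @le_ln1Dx R (- 2^-1); rewrite (_ : 1 + - 2^-1 = 2^-1 :> R); last by lra.
rewrite lnV ?posrE // => h; have := h _; lra.
Qed.

Theorem theorem1p2 (R : realType) :
  exists (D : pred nat) (C : R),
    [/\ ~~ D 0%N,
        (fun X : nat => (count D (iota 1 X))%:R / X%:R : R) @ \oo --> (1 : R),
        0 < C
      & forall d n : nat, (2 <= d)%N -> (2 <= n)%N -> D d ->
          Num.sqrt (d%:R : R) * ln (d%:R : R) <= n%:R ->
          `| ratr (soluble_ratio d n) - 1 | <= C / Num.sqrt (d%:R : R)].
Proof.
exists tame, 24; split => //; first exact: density_tame.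
move=> d n d2 _ Dd dn; apply: soluble_ratio_sqrt => //.
(* It remains to show 2(K+1) <= ln d, which follows from (K+1) ln 16 <= ln d. *)
apply: le_trans dn; rewrite mulrC ler_wpM2l ?sqrtr_ge0 //.
set K := (2 ^ _)%N.
have : ln (16 ^+ K.+1) <= ln d%:R :> R.
  by rewrite ler_ln ?posrE ?exprn_gt0 ?ltr0n ?(leq_trans _ d2) // -natrX ler_nat.
apply: le_trans; rewrite lnXn // -[leRHS]mulr_natr ler_wpM2r //.
rewrite (_ : 16 = 2 ^+ 4); last by rewrite -natrX.
rewrite lnXn //; have := ln2_ge_half R; lra.
Qed.
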